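(* Let $N \geq 1$ be an integer and let $\sigma: \{0, 1, \dots, N-1\} \to \{0, 1, \dots, N-1\}$ be any permutation. Then $$ L_2^{\mathrm{per}}(\sigma)^2 - 4\, L_2^{\mathrm{extr}}(\sigma)^2 = \frac{N^2+1}{18N^2}, $$ where $L_2^{\mathrm{per}}(\sigma)$ and $L_2^{\mathrm{extr}}(\sigma)$ denote the periodic and extreme $L_2$-discrepancy of the permutation set $X(\sigma) \subseteq [0,1)^2$.
   Context: For a permutation $\sigma$ of $\{0,1,\dots,N-1\}$ the permutation set is $X(\sigma) = \left\{\left(\frac{m}{N}, \frac{\sigma(m)}{N}\right): m=0, 1, \dots, N-1\right\} \subseteq [0,1)^2$, a set of $N$ points. For $x, y \in [0,1)$ the (periodic) interval is $[x,y) = \{z \in [0,1): x \leq z < y\}$ if $x<y$, and $[x,y) = \{z \in [0,1): x \leq z \text{ or } z < y\}$ if $x \geq y$. For $\mathbf{x} = (x_1,\dots,x_d), \mathbf{y} = (y_1,\dots,y_d) \in [0,1)^d$ put $[\mathbf{x},\mathbf{y}) = \prod_{k=1}^d [x_k,y_k)$ and let $|[\mathbf{x},\mathbf{y})|$ be its Lebesgue measure, i.e. the product over $k$ of $y_k - x_k$ if $x_k<y_k$ and of $1-x_k+y_k$ if $x_k \geq y_k$. For a finite set $X \subseteq [0,1)^d$ with $\#X = N$ the discrepancy function is $D_X(\mathbf{x},\mathbf{y}) = \#(X \cap [\mathbf{x},\mathbf{y})) - N\,|[\mathbf{x},\mathbf{y})|$ (not normalized by $N$). The extreme and periodic $L_2$-discrepancies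 (nonnegative square roots) are given by $$L_2^{\mathrm{extr}}(X)^2 = \int_{[0,1)^d} \int_{\mathbf{y} > \mathbf{x}} D_X(\mathbf{x},\mathbf{y})^2 \, d\mathbf{y}\, d\mathbf{x}, \qquad L_2^{\mathrm{per}}(X)^2 = \int_{[0,1)^d} \int_{[0,1)^d} D_X(\mathbf{x},\mathbf{y})^2 \, d\mathbf{y}\, d\mathbf{x},$$ where in the first integral $\mathbf{y} \in [0,1)^d$ and $\mathbf{y}>\mathbf{x}$ is meant componentwise. Here $d=2$, and $L_2^{\mathrm{per}}(\sigma) = L_2^{\mathrm{per}}(X(\sigma))$, $L_2^{\mathrm{extr}}(\sigma) = L_2^{\mathrm{extr}}(X(\sigma))$. *)

(* Defs.v *)
From mathcomp Require Import all_boot all_order all_algebra all_fingroup.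
From mathcomp Require Import finmap.
From mathcomp Require Import all_classical all_reals all_analysis.

Set Implicit Arguments.
Unset Strict Implicit.
Unset Printing Implicit Defensive.

Import Order.TTheory GRing.Theory Num.Theory.
Import numFieldNormedType.Exports.

Local Open Scope classical_set_scope.
Local Open Scope ring_scope.

Definition mu2 (R : realType) : set (measurableTypeR R * measurableTypeR R) -> \bar R :=
  (@lebesgue_measure R \x @lebesgue_measure R)%E.
Arguments mu2 : clear implicits.

Definition unit_square (R : realType) : set (R * R) :=
  `[0, 1[%classic `*` `[0, 1[%classic.
Arguments unit_square : clear implicits.

(* As a subset of the circle [0, 1); it wraps around 0 when y <= x, and it is
   all of [0, 1) when x = y. *)
Definition per_itv (R : realType) (x y : R) : set R :=
  if x < y then [set z | 0 <= z < 1 /\ x <= z < y]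
  else [set z | 0 <= z < 1 /\ (x <= z \/ z < y)].

Definition per_box (R : realType) (x y : R * R) : set (R * R) :=
  per_itv x.1 y.1 `*` per_itv x.2 y.2.

(* Not normalized by the number of points of X. *)
Definition discrepancy (R : realType) (X : {fset R * R}) (x y : R * R) : R :=
  #|` [fset p in X | p \in per_box x y]%fset |%:R
  - #|` X|%:R * fine (mu2 R (per_box x y)).

Definition L2_extr (R : realType) (X : {fset R * R}) : R :=
  Num.sqrt (fine
    (\int[mu2 R]_(x in unit_square R)
      \int[mu2 R]_(y in [set y | unit_square R y /\ (x.1 < y.1)%R /\ (x.2 < y.2)%R])
        (discrepancy X x y ^+ 2)%:E)%E).

Definition L2_per (R : realType) (X : {fset R * R}) : R :=
  Num.sqrt (fine
    (\int[mu2 R]_(x in unit_square R) \int[mu2 R]_(y in unit_square R)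
        (discrepancy X x y ^+ 2)%:E)%E).

Definition perm_set (R : realType) (N : nat) (sigma : 'S_N) : {fset R * R} :=
  [fset ((nat_of_ord m)%:R / N%:R, (sigma m)%:R / N%:R) | m in 'I_N]%fset.

(* Main.v *)
Require Import Defs.
From mathcomp Require Import all_boot all_order all_algebra all_fingroup.
From mathcomp Require Import finmap.
From mathcomp Require Import all_classical all_reals all_analysis.
From mathcomp Require Import measurable_realfun ring lra.

(** Write [u_s(x,y)] for the indicator of [s] in the periodic interval [x,y) and
[l(x,y)] for its length.  For the points [p_i = (a_i, b_i)] of the permutation
set, [D(x,y) = sum_i u_(a_i)(x1,y1) u_(b_i)(x2,y2) - N l(x1,y1) l(x2,y2)], so
[D^2] is a finite linear combination of products of a function of [(x1,y1)] and
a function of [(x2,y2)].  By Fubini ([has_iint_prod]) both squared discrepancies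
are therefore determined by the double integrals, in one dimension, of
[u_s u_t], [u_s l] and [l^2] ([has_iint_square]).

With [f(s) = s(1-s)] and [g(s,t) = |s-t|(1-|s-t|)] these are
- over the whole square (periodic case): [1/2 - g(s,t)], [1/3] and [1/3];
- over [x < y] (extreme case): [(f(s)+f(t)-g(s,t))/2], [f(s)/2] and [1/12].

Hence in [L_per^2 - 4 L_extr^2] the pair [(i,j)] contributes
[(1/2-g)(1/2-h) - (f(a_i)+f(a_j)-g)(f(b_i)+f(b_j)-h)], where [g] and [h] are the
values of the quadratic distance at the abscissas and at the ordinates.  The only
term that couples the two distances, [g h], cancels; this is why the factor is 4.
Each remaining distance sum [sum_j g(a_i,a_j)] runs over the whole grid [j/N],
does not depend on [i] by periodicity, and equals
[S = sum_i f(i/N) = (N^2-1)/(6N)] ([sum_qdist]); a permutation does not change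
such sums.  What still depends on the permutation is [sum_i f(a_i) f(b_i)], with
coefficient [-2N] from the double sum and [+2N] from the mixed terms [u_s l]
([sum_defect]).  The rest is
[N^2/4 - N S + 2 S^2 - 5 N^2/36 = (N^2+1)/(18 N^2)]. *)

Import Order.TTheory GRing.Theory Num.Theory.
Import numFieldNormedType.Exports.
Local Open Scope classical_set_scope.
Local Open Scope ring_scope.

Set Implicit Arguments.
Unset Strict Implicit.
Unset Printing Implicit Defensive.

(** * Functions with a known integral *)

(** Integrability and the value are kept together so that sums and unions can be
treated without separate integrability side conditions. *)
Definition has_int d (T : measurableType d) (R : realType)
    (mu : {measure set T -> \bar R}) (D : set T) (f : T -> R) (v : R) : Prop :=
  mu.-integrable D (EFin \o f) /\ (\int[mu]_(x in D) (f x)%:E)%E = v%:E.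

Section HasInt.
Context d (T : measurableType d) (R : realType).
Variables (mu : {measure set T -> \bar R}) (D : set T).
Hypothesis mD : measurable D.
Implicit Types (f g : T -> R) (u v k : R).

Lemma has_int_eq f g u : (forall x, D x -> g x = f x) ->
  has_int mu D f u -> has_int mu D g u.
Proof.
move=> fg [fi fu]; split.
  by apply: (eq_integrable mD (EFin \o f)) => // x; rewrite inE => Dx /=; rewrite fg.
by rewrite -fu; apply: eq_integral => x; rewrite inE => Dx; rewrite fg.
Qed.

Lemma has_intD f g u v : has_int mu D f u -> has_int mu D g v ->
  has_int mu D (fun x => f x + g x) (u + v).
Proof.
move=> [fi fu] [gi gv]; split; first exact: (integrableD mD fi gi).
by rewrite EFinD -fu -gv -(integralD mD fi gi).
Qed.

Lemma has_intZ k f u : has_int mu D f u -> has_int mu D (fun x => k * f x) (k * u).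
Proof.
move=> [fi fu]; split; first exact: (integrableZl mD k fi).
by rewrite EFinM -fu -(integralZl mD fi).
Qed.

Lemma has_int0 : has_int mu D (fun=> 0) 0.
Proof. by split; [exact: integrable0 | exact: integral0]. Qed.

Lemma has_int_sum (I : Type) (s : seq I) (F : I -> T -> R) (U : I -> R) :
  (forall i, has_int mu D (F i) (U i)) ->
  has_int mu D (fun x => \sum_(i <- s) F i x) (\sum_(i <- s) U i).
Proof.
move=> FU; elim: s => [|i s ih].
  by rewrite big_nil; apply: has_int_eq has_int0 => x _; rewrite big_nil.
rewrite big_cons; apply: has_int_eq (has_intD (FU i) ih) => x _.
by rewrite big_cons.
Qed.

End HasInt.

(** Extending both functions by zero reduces the claim to the whole product
space; there Tonelli on the absolute values gives integrability, and Fubini then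
gives the value. *)
Lemma has_int_prod d1 d2 (T1 : measurableType d1) (T2 : measurableType d2)
    (R : realType) (m1 : {sigma_finite_measure set T1 -> \bar R})
    (m2 : {sigma_finite_measure set T2 -> \bar R})
    (A : set T1) (B : set T2) (f : T1 -> R) (g : T2 -> R) (u v : R) :
  measurable A -> measurable B ->
  has_int m1 A f u -> has_int m2 B g v ->
  has_int (m1 \x m2)%E (A `*` B) (fun p => f p.1 * g p.2) (u * v).
Proof.
move=> mA mB [fi fu] [gi gv].
have mAB : measurable (A `*` B) by exact: measurableX.
pose fA := f \_ A; pose gB := g \_ B.
have fAi : m1.-integrable setT (EFin \o fA).
  by rewrite /fA -restrict_EFin; exact/(integrable_mkcond _ mA).
have gBi : m2.-integrable setT (EFin \o gB).
  by rewrite /gB -restrict_EFin; exact/(integrable_mkcond _ mB).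
have mfA : measurable_fun setT fA by exact/measurable_EFinP/(measurable_int m1).
have mgB : measurable_fun setT gB by exact/measurable_EFinP/(measurable_int m2).
pose h p := fA p.1 * gB p.2.
have hE : (EFin \o (fun p => f p.1 * g p.2)) \_ (A `*` B) = EFin \o h.
  apply/funext => -[x y] /=; rewrite /h /fA /gB /patch /= in_setX /=.
  by case: (x \in A) => /=; [case: (y \in B) => /=; rewrite ?mulr0 | rewrite mul0r].
have mh : measurable_fun setT (EFin \o h).
  apply/measurable_EFinP; apply: measurable_funM.
    by apply: measurableT_comp => //; exact: measurable_fst.
  by apply: measurableT_comp => //; exact: measurable_snd.
have hi : (m1 \x m2)%E.-integrable setT (EFin \o h).
  apply/integrable12ltyP => //.
  pose c := fine (\int[m2]_y `|(gB y)%:E|)%E.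
  have cE : (\int[m2]_y `|(gB y)%:E|)%E = c%:E.
    rewrite fineK// fin_numElt; have [_ ->] := integrableP _ _ _ gBi.
    by rewrite andbT (lt_le_trans ltNy0)// integral_ge0.
  under eq_integral => x _.
    under eq_integral => y _ do rewrite /h /= normrM EFinM.
    rewrite ge0_integralZl//; last first.
      by apply/measurable_EFinP; apply: measurableT_comp.
    rewrite [X in (_ * X)%E]cE muleC.
    over.
  rewrite ge0_integralZl//; last 2 first.
  - by apply/measurable_EFinP; apply: measurableT_comp.
  - by rewrite -cE integral_ge0.
  have [_ foo] := integrableP _ _ _ fAi.
  by rewrite lte_mul_pinfty// -cE integral_ge0.
split; first by apply/(integrable_mkcond _ mAB); rewrite hE.
rewrite integral_mkcond [X in (\int[_]_(x in _) (X x))%E]hE -integral12_prod_meas1// /fubini_F.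
have fAu : (\int[m1]_x (fA x)%:E)%E = u%:E.
  by rewrite -fu integral_mkcond restrict_EFin.
have gBv : (\int[m2]_x (gB x)%:E)%E = v%:E.
  by rewrite -gv integral_mkcond restrict_EFin.
under eq_integral => x _.
  under eq_integral => y _ do rewrite /h /= EFinM.
  rewrite integralZl// gBv muleC.
  over.
by rewrite integralZl// fAu muleC EFinM.
Qed.

Lemma has_int_setU d (T : measurableType d) (R : realType)
    (mu : {measure set T -> \bar R}) (A B : set T) (f : T -> R) (u v : R) :
  measurable A -> measurable B -> [disjoint A & B] ->
  has_int mu A f u -> has_int mu B f v -> has_int mu (A `|` B) f (u + v).
Proof.
move=> mA mB AB [fA fu] [fB fv].
have mf : measurable_fun (A `|` B) (EFin \o f).
  by apply/measurable_funU => //; split; exact: (measurable_int mu).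
split; last by rewrite integral_setU// fu fv.
apply/integrableP; split => //.
rewrite ge0_integral_setU//; last exact: measurableT_comp.
by apply: lte_add_pinfty; [case/integrableP: fA | case/integrableP: fB].
Qed.

(** * Piecewise polynomials on an interval *)

Section Interval.
Variable R : realType.
Notation leb := (@lebesgue_measure R).
Implicit Types (a b c : R).

(** The endpoints are null sets, so the fundamental theorem of calculus on [a, b]
applies whichever endpoints belong to the interval. *)
Lemma has_int_deriv (P : {poly R}) a b (s t : bool) : a <= b ->
  has_int leb [set` Interval (BSide s a) (BSide t b)] (horner P^`()) (P.[b] - P.[a]).
Proof.
move=> ab.
have sub : [set` Interval (BSide s a) (BSide t b)] `<=` `[a, b].
  apply: subset_itv; first by case: s; rewrite bnd_simp.
  by case: t; rewrite bnd_simp.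
have iab : leb.-integrable `[a, b] (EFin \o horner P^`()).
  apply: continuous_compact_integrable; first exact: segment_compact.
  exact/continuous_subspaceT/continuous_horner.
split; first exact: integrableS iab.
move: ab; rewrite le_eqVlt => /predU1P[-> | ab].
  by rewrite subrr; case: s {sub}; case: t; rewrite !set_itvE ?integral_set0 ?integral_set1.
have moo : measurable_fun `]a, b[ (EFin \o horner P^`()).
  by apply: measurable_funS (measurable_int leb iab) => //; exact: subset_itv_oo_cc.
rewrite integral_itv_bndoo; last first.
  exact: moo.
rewrite -(@integral_itv_bndoo _ _ _ _ true false); last first.
  exact: moo.
rewrite (@continuous_FTC2 _ (horner P^`()) (horner P))//.
- exact/continuous_subspaceT/continuous_horner.
- split; first by move=> x _; exact: derivable_horner.
  + exact/cvg_at_right_filter/continuous_horner.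
  + exact/cvg_at_left_filter/continuous_horner.
- by move=> x _; rewrite derivE.
Qed.

(** Degree three covers every integrand below: the extreme inner integral of the
squared length is [(1 - x)^3 / 3]. *)
Lemma has_int_cubic (f : R -> R) (c0 c1 c2 c3 v : R) a b (s t : bool) : a <= b ->
  (forall x, x \in Interval (BSide s a) (BSide t b) ->
     f x = c0 + c1 * x + c2 * x ^+ 2 + c3 * x ^+ 3) ->
  v = c0 * (b - a) + c1 * (b ^+ 2 - a ^+ 2) / 2 + c2 * (b ^+ 3 - a ^+ 3) / 3
      + c3 * (b ^+ 4 - a ^+ 4) / 4 ->
  has_int leb [set` Interval (BSide s a) (BSide t b)] f v.
Proof.
move=> ab fE ->.
pose P : {poly R} := c0 *: 'X + (c1 / 2) *: 'X^2 + (c2 / 3) *: 'X^3 + (c3 / 4) *: 'X^4.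
have := @has_int_deriv P a b s t ab.
rewrite (_ : P.[b] - P.[a] = c0 * (b - a) + c1 * (b ^+ 2 - a ^+ 2) / 2
  + c2 * (b ^+ 3 - a ^+ 3) / 3 + c3 * (b ^+ 4 - a ^+ 4) / 4); last first.
  by rewrite /P !(hornerD, hornerZ, hornerXn, hornerX); field.
apply: has_int_eq => [|x /= xab]; first exact: measurable_itv.
by rewrite fE// /P !poly.derivE !(hornerD, hornerZ, hornerMn, hornerXn, hornerX, hornerC) /=; field.
Qed.

(** The cut is a bound of an interval rather than a point: the integrands jump,
and the side of the cut decides which piece gets the point itself. *)
Lemma has_int_split (k : itv_bound R) (u v w : R) (f : R -> R) (i j : itv_bound R) :
  w = u + v -> (i <= k)%O -> (k <= j)%O ->
  has_int leb [set` Interval i k] f u -> has_int leb [set` Interval k j] f v ->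
  has_int leb [set` Interval i j] f w.
Proof.
move=> -> ik kj fu fv; rewrite (itv_bndbnd_setU ik kj).
apply: has_int_setU => //.
apply/disj_setPS => x [/=]; rewrite !itv_boundlr => /andP[_ xk] /andP[kx _].
by have := le_trans xk kx; rewrite bnd_simp ltxx.
Qed.

End Interval.

(** * Iterated integrals *)

(** The inner domain [E x] may depend on the outer variable: it is constant for the
periodic discrepancy and consists of the [y > x] for the extreme one. *)
Definition has_iint d (T : measurableType d) (R : realType)
    (mu : {measure set T -> \bar R}) (D : set T) (E : T -> set T)
    (phi : T -> T -> R) (v : R) : Prop :=
  exists Phi, (forall x, D x -> has_int mu (E x) (phi x) (Phi x)) /\
    has_int mu D Phi v.

Section HasIint.
Context d (T : measurableType d) (R : realType).
Variables (mu : {measure set T -> \bar R}) (D : set T) (E : T -> set T).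
Hypotheses (mD : measurable D) (mE : forall x, measurable (E x)).
Implicit Types (f g : T -> T -> R) (u v k : R).

Lemma has_iint_eq f g u : (forall x y, D x -> E x y -> g x y = f x y) ->
  has_iint mu D E f u -> has_iint mu D E g u.
Proof.
move=> fg [F [Ff Fu]]; exists F; split => // x Dx.
by apply: has_int_eq (Ff x Dx) => // y Ey; exact: fg.
Qed.

Lemma has_iintD f g u v : has_iint mu D E f u -> has_iint mu D E g v ->
  has_iint mu D E (fun x y => f x y + g x y) (u + v).
Proof.
move=> [F [Ff Fu]] [G [Gg Gv]]; exists (fun x => F x + G x); split.
  by move=> x Dx; apply: has_intD; auto.
exact: has_intD.
Qed.

Lemma has_iintZ k f u : has_iint mu D E f u ->
  has_iint mu D E (fun x y => k * f x y) (k * u).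
Proof.
move=> [F [Ff Fu]]; exists (fun x => k * F x); split.
  by move=> x Dx; apply: has_intZ; auto.
exact: has_intZ.
Qed.

Lemma has_iint_sum (I : finType) (F : I -> T -> T -> R) (U : I -> R) :
  (forall i, has_iint mu D E (F i) (U i)) ->
  has_iint mu D E (fun x y => \sum_i F i x y) (\sum_i U i).
Proof.
move=> /choice[G GFU]; exists (fun x => \sum_i G i x); split.
  by move=> x Dx; apply: has_int_sum => // i; case: (GFU i) => + _; exact.
by apply: has_int_sum => // i; case: (GFU i).
Qed.

Lemma has_iint_integral f u : has_iint mu D E f u ->
  (\int[mu]_(x in D) \int[mu]_(y in E x) (f x y)%:E)%E = u%:E.
Proof.
move=> [F [Ff [_ <-]]]; apply: eq_integral => x; rewrite inE => Dx.
by case: (Ff x Dx).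
Qed.

End HasIint.

(** At fixed [x] the integrand is a product of a function of [y.1] and one of [y.2];
after integration over [y] it is a product of functions of [x.1] and [x.2].  Thus
[has_int_prod] applies to the inner integrals and then to the outer one. *)
Lemma has_iint_prod d1 d2 (T1 : measurableType d1) (T2 : measurableType d2)
    (R : realType) (m1 : {sigma_finite_measure set T1 -> \bar R})
    (m2 : {sigma_finite_measure set T2 -> \bar R})
    (D1 : set T1) (E1 : T1 -> set T1) (D2 : set T2) (E2 : T2 -> set T2)
    (f : T1 -> T1 -> R) (g : T2 -> T2 -> R) (u v : R) :
  measurable D1 -> measurable D2 ->
  (forall x, measurable (E1 x)) -> (forall x, measurable (E2 x)) ->
  has_iint m1 D1 E1 f u -> has_iint m2 D2 E2 g v ->
  has_iint (m1 \x m2)%E (D1 `*` D2) (fun x => E1 x.1 `*` E2 x.2)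
    (fun x y => f x.1 y.1 * g x.2 y.2) (u * v).
Proof.
move=> mD1 mD2 mE1 mE2 [F [Ff Fu]] [G [Gg Gv]].
exists (fun x => F x.1 * G x.2); split; last exact: has_int_prod.
by move=> [x1 x2] [/= Dx1 Dx2]; apply: has_int_prod; auto.
Qed.

(** * The one-dimensional integrals *)

Notation periodic_range R := (fun _ : measurableTypeR R => `[(0:R), (1:R)[%classic).
Notation extreme_range R := (fun x : measurableTypeR R => `](x:R), (1:R)[%classic).

Section Kernels.
Variable R : realType.
Notation leb := (@lebesgue_measure R).
Implicit Types (s t x y : R).

Definition arc_mem s x y : R :=
  (if x < y then x <= s < y else (x <= s) || (s < y))%:R.

Definition arc_len x y : R := if x < y then y - x else 1 - x + y.

(** The intervals below are cut so that every order comparison in the integrand has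
a constant truth value on each piece. *)
Ltac decide_orders := repeat match goal with
  | |- context [(?a <= ?b)%R] => first
      [ rewrite (_ : (a <= b)%R = true); last by lra
      | rewrite (_ : (a <= b)%R = false); last by apply/negbTE; rewrite -ltNge; lra ]
  | |- context [(?a < ?b)%R] => first
      [ rewrite (_ : (a < b)%R = true); last by lra
      | rewrite (_ : (a < b)%R = false); last by apply/negbTE; rewrite -leNgt; lra ]
  end.

(** The arguments are the coefficients of the polynomial that the integrand is on
the interval at hand. *)
Ltac piece c0 c1 c2 c3 := apply: (@has_int_cubic _ _ c0 c1 c2 c3);
  [lra | let y := fresh "y" in move=> y; rewrite in_itv /= => /andP[? ?];
         rewrite /= /arc_mem /arc_len; decide_orders; rewrite /=; field
  | lra].

Ltac cut_at k u v := apply: (@has_int_split _ k u v);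
  [lra | rewrite bnd_simp; lra | rewrite bnd_simp; lra | |].

(** Both points lie in [x, y) exactly when [x <= s] and [t < y]. *)
Lemma extreme_mem_mem_le s t : 0 <= s -> s <= t -> t < 1 ->
  has_iint leb `[0, 1[ (extreme_range R)
    (fun x y => arc_mem s x y * arc_mem t x y) (s * (1 - t)).
Proof.
move=> s0 st t1; exists (fun x => if x <= s then 1 - t else 0); split.
  move=> x /=; rewrite in_itv /= => /andP[x0 x1].
  case: leP => xs; last by piece (0:R) (0:R) (0:R) (0:R).
  cut_at (BRight t) (0:R) (1 - t).
    by piece (0:R) (0:R) (0:R) (0:R).
  by piece (1:R) (0:R) (0:R) (0:R).
cut_at (BRight s) (s * (1 - t)) (0:R).
  by piece (1 - t) (0:R) (0:R) (0:R).
by piece (0:R) (0:R) (0:R) (0:R).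
Qed.

Lemma extreme_mem_len s : 0 <= s -> s < 1 ->
  has_iint leb `[0, 1[ (extreme_range R)
    (fun x y => arc_mem s x y * arc_len x y) (s * (1 - s) / 2).
Proof.
move=> s0 s1.
exists (fun x => if x <= s then (1 - s ^+ 2) / 2 - x * (1 - s) else 0); split.
  move=> x /=; rewrite in_itv /= => /andP[x0 x1].
  case: leP => xs; last by piece (0:R) (0:R) (0:R) (0:R).
  cut_at (BRight s) (0:R) ((1 - s ^+ 2) / 2 - x * (1 - s)).
    by piece (0:R) (0:R) (0:R) (0:R).
  by piece (- x) (1:R) (0:R) (0:R).
cut_at (BRight s) (s * (1 - s) / 2) (0:R).
  by piece ((1 - s ^+ 2) / 2) (s - 1) (0:R) (0:R).
by piece (0:R) (0:R) (0:R) (0:R).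
Qed.

Lemma extreme_len_len :
  has_iint leb `[0, 1[ (extreme_range R)
    (fun x y => arc_len x y * arc_len x y) (1 / 12).
Proof.
exists (fun x => (1 - x) ^+ 3 / 3); split.
  move=> x /=; rewrite in_itv /= => /andP[x0 x1].
  by piece (x ^+ 2) (- 2 * x) (1:R) (0:R).
by piece (1 / 3 : R) (- 1 : R) (1 : R) (- 1 / 3 : R).
Qed.

(** On the circle [s] and [t] both lie in [x, y) exactly when no point of [y, x)
does, i.e. when [x] and [y] fall, in the right order, into the same one of the two
arcs cut out by [s] and [t].  The arcs have lengths [d = t - s] and [1 - d], so the
measure is [d^2/2 + (1-d)^2/2]. *)
Lemma periodic_mem_mem_le s t : 0 <= s -> s <= t -> t < 1 ->
  has_iint leb `[0, 1[ (periodic_range R)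
    (fun x y => arc_mem s x y * arc_mem t x y)
    (1 / 2 - (t - s) * (1 - (t - s))).
Proof.
move=> s0 st t1.
exists (fun x => if x <= s then 1 - t + x else if x <= t then x - s else x - t); split.
  move=> x /=; rewrite in_itv /= => /andP[x0 x1].
  case: leP => xs; [|case: leP => xt].
  - cut_at (BRight x) x (1 - t); first by piece (1:R) (0:R) (0:R) (0:R).
    cut_at (BRight t) (0:R) (1 - t); first by piece (0:R) (0:R) (0:R) (0:R).
    by piece (1:R) (0:R) (0:R) (0:R).
  - cut_at (BRight s) (0:R) (x - s); first by piece (0:R) (0:R) (0:R) (0:R).
    cut_at (BRight x) (x - s) (0:R); first by piece (1:R) (0:R) (0:R) (0:R).
    by piece (0:R) (0:R) (0:R) (0:R).
  - cut_at (BRight t) (0:R) (x - t); first by piece (0:R) (0:R) (0:R) (0:R).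
    cut_at (BRight x) (x - t) (0:R); first by piece (1:R) (0:R) (0:R) (0:R).
    by piece (0:R) (0:R) (0:R) (0:R).
cut_at (BRight s) (s * (1 - t) + s ^+ 2 / 2) ((t - s) ^+ 2 / 2 + (1 - t) ^+ 2 / 2).
  by piece (1 - t) (1:R) (0:R) (0:R).
cut_at (BRight t) ((t - s) ^+ 2 / 2) ((1 - t) ^+ 2 / 2).
  by piece (- s) (1:R) (0:R) (0:R).
by piece (- t) (1:R) (0:R) (0:R).
Qed.

(** By rotation invariance the length is uniform on [0, 1), and an arc of length [l]
contains [s] with probability [l]; so the value is the integral of [l^2]. *)
Lemma periodic_mem_len s : 0 <= s -> s < 1 ->
  has_iint leb `[0, 1[ (periodic_range R)
    (fun x y => arc_mem s x y * arc_len x y) (1 / 3).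
Proof.
move=> s0 s1.
exists (fun x => if x <= s then (1 - (s - x) ^+ 2) / 2
                 else (1 - (1 - x + s) ^+ 2) / 2); split.
  move=> x /=; rewrite in_itv /= => /andP[x0 x1].
  case: leP => xs.
  - cut_at (BRight x) (x * (1 - x) + x ^+ 2 / 2) ((1 - s ^+ 2) / 2 - x * (1 - s)).
      by piece (1 - x) (1:R) (0:R) (0:R).
    cut_at (BRight s) (0:R) ((1 - s ^+ 2) / 2 - x * (1 - s)).
      by piece (0:R) (0:R) (0:R) (0:R).
    by piece (- x) (1:R) (0:R) (0:R).
  - cut_at (BRight s) (0:R) ((1 - (1 - x + s) ^+ 2) / 2).
      by piece (0:R) (0:R) (0:R) (0:R).
    cut_at (BRight x) ((1 - (1 - x + s) ^+ 2) / 2) (0:R).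
      by piece (1 - x) (1:R) (0:R) (0:R).
    by piece (0:R) (0:R) (0:R) (0:R).
cut_at (BRight s) (s / 2 - s ^+ 3 / 6) ((1 - s) / 2 - (1 - s ^+ 3) / 6).
  by piece ((1 - s ^+ 2) / 2) s (- 1 / 2 : R) (0:R).
by piece ((1 - (1 + s) ^+ 2) / 2) (1 + s) (- 1 / 2 : R) (0:R).
Qed.

Lemma periodic_len_len :
  has_iint leb `[0, 1[ (periodic_range R)
    (fun x y => arc_len x y * arc_len x y) (1 / 3).
Proof.
exists (fun=> 1 / 3); split; last by piece (1 / 3 : R) (0 : R) (0 : R) (0 : R).
move=> x /=; rewrite in_itv /= => /andP[x0 x1].
cut_at (BRight x) ((1 - (1 - x) ^+ 3) / 3) ((1 - x) ^+ 3 / 3).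
  by piece ((1 - x) ^+ 2) (2 * (1 - x)) (1:R) (0:R).
by piece (x ^+ 2) (- 2 * x) (1:R) (0:R).
Qed.

(** The product of the lengths of the two arcs that [s] and [t] cut out of the
circle of length 1. *)
Definition qdist (s t : R) : R := `|s - t| * (1 - `|s - t|).

Lemma qdistC s t : qdist s t = qdist t s.
Proof. by rewrite /qdist distrC. Qed.

Lemma qdist_le s t : s <= t -> qdist s t = (t - s) * (1 - (t - s)).
Proof. by move=> st; rewrite qdistC /qdist ger0_norm// subr_ge0. Qed.

Lemma extreme_mem_mem s t : 0 <= s < 1 -> 0 <= t < 1 ->
  has_iint leb `[0, 1[ (extreme_range R)
    (fun x y => arc_mem s x y * arc_mem t x y)
    ((s * (1 - s) + t * (1 - t) - qdist s t) / 2).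
Proof.
wlog st : s t / s <= t => [th|] /andP[s0 s1] /andP[t0 t1].
  have [st|/ltW ts] := leP s t; first by apply: th; rewrite ?s0 ?t0.
  rewrite qdistC (addrC (s * _)).
  have := th _ _ ts; rewrite s0 s1 t0 t1 => /(_ isT isT).
  by apply: has_iint_eq => // x y _ _; rewrite mulrC.
rewrite qdist_le// (_ : _ / 2 = s * (1 - t)); last by field.
exact: extreme_mem_mem_le.
Qed.

Lemma periodic_mem_mem s t : 0 <= s < 1 -> 0 <= t < 1 ->
  has_iint leb `[0, 1[ (periodic_range R)
    (fun x y => arc_mem s x y * arc_mem t x y) (1 / 2 - qdist s t).
Proof.
wlog st : s t / s <= t => [th|] /andP[s0 s1] /andP[t0 t1].
  have [st|/ltW ts] := leP s t; first by apply: th; rewrite ?s0 ?t0.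
  rewrite qdistC.
  have := th _ _ ts; rewrite s0 s1 t0 t1 => /(_ isT isT).
  by apply: has_iint_eq => // x y _ _; rewrite mulrC.
rewrite qdist_le//; exact: periodic_mem_mem_le.
Qed.

End Kernels.

(** * Sums over the grid *)

Section Sums.
Variable R : realType.

Lemma sum_quad (p q r : R) (n : nat) :
  \sum_(i < n) (p + q * i%:R + r * i%:R ^+ 2) =
  p * n%:R + q * (n%:R * (n%:R - 1) / 2) + r * (n%:R * (n%:R - 1) * (2 * n%:R - 1) / 6).
Proof.
elim: n => [|n IHn]; first by rewrite big_ord0; field.
by rewrite big_ord_recr /= IHn -natr1; field.
Qed.

Section Grid.
Variable N : nat.
Hypothesis N_gt0 : (0 < N)%N.
Notation S := ((N%:R ^+ 2 - 1) / (6 * N%:R) : R).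

Let N0 : N%:R != 0 :> R. Proof. by rewrite pnatr_eq0 -lt0n. Qed.

Lemma sum_grid : \sum_(i < N) (i%:R / N%:R * (1 - i%:R / N%:R)) = S.
Proof.
transitivity (\sum_(i < N) (0 + N%:R^-1 * i%:R + (- N%:R ^- 2) * i%:R ^+ 2) : R).
  by apply: eq_bigr => i _; field.
by rewrite sum_quad; field.
Qed.

(** [qdist] is periodic, so the sum does not depend on [k] and is the one for
[k = 0], which is [sum_grid].  With the cut at [i = k] both parts are sums of
quadratic polynomials and the two closed forms add up to the same value. *)
Lemma sum_qdist (k : nat) : (k < N)%N ->
  \sum_(i < N) qdist (k%:R / N%:R) (i%:R / N%:R) = S.
Proof.
move=> kN.
have lemN i j : (i <= j)%N -> i%:R / N%:R <= j%:R / N%:R :> R.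
  by move=> ij; rewrite ler_pM2r ?ler_nat// invr_gt0 ltr0n.
rewrite -(big_mkord xpredT (fun i => qdist (k%:R / N%:R) (i%:R / N%:R))).
rewrite (big_cat_nat (n := k))//=; last exact: ltnW.
have -> F : \sum_(k <= i < N) F i = \sum_(0 <= i < N - k) F (i + k)%N :> R.
  by rewrite -{1}(add0n k) big_addn.
rewrite !big_mkord.
rewrite (eq_bigr (fun i : 'I_k => (k%:R / N%:R * (1 - k%:R / N%:R))
    + (2 * k%:R / N%:R ^+ 2 - N%:R^-1) * i%:R + (- N%:R ^- 2) * i%:R ^+ 2)); last first.
  move=> i _; rewrite qdistC qdist_le ?lemN ?(ltnW (ltn_ord i))//.
  by field.
rewrite [X in _ + X](eq_bigr (fun i : 'I_(N - k) => 0
    + N%:R^-1 * i%:R + (- N%:R ^- 2) * i%:R ^+ 2)); last first.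
  move=> i _; rewrite qdist_le ?lemN ?leq_addl//.
  by rewrite natrD; field.
by rewrite !sum_quad natrB ?(ltnW kN)//; field.
Qed.

End Grid.

(** The products [G i j * H i j] cancel.  By the constant row sums everything else
reduces to [s], except [sum_i fa i * fb i], which occurs once from the diagonal
products [fa i * fb i] and once from the products [fa j * fb j]. *)
Lemma sum_defect (I : finType) (fa fb : I -> R) (G H : I -> I -> R) (s : R) :
  (forall i j, G i j = G j i) -> (forall i j, H i j = H j i) ->
  (forall i, \sum_j G i j = s) -> (forall i, \sum_j H i j = s) ->
  \sum_i fa i = s -> \sum_i fb i = s ->
  \sum_i \sum_j ((1 / 2 - G i j) * (1 / 2 - H i j)
     - (fa i + fa j - G i j) * (fb i + fb j - H i j))
  = #|I|%:R ^+ 2 / 4 - #|I|%:R * s + 2 * s ^+ 2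
    - 2 * #|I|%:R * \sum_i fa i * fb i.
Proof.
move=> GC HC Gs Hs fas fbs; set P := \sum_i fa i * fb i.
have inner i : \sum_j ((1 / 2 - G i j) * (1 / 2 - H i j)
     - (fa i + fa j - G i j) * (fb i + fb j - H i j))
   = (#|I|%:R / 4 - s - P) + (- #|I|%:R) * (fa i * fb i)
     + \sum_j G i j * fb j + \sum_j H i j * fa j.
  (* [c] is opaque so that [big_split] does not split this constant term *)
  have [c cE] : exists c, c = 1 / 4 - fa i * fb i by eexists.
  transitivity (\sum_j (c + (fb i - 1 / 2) * G i j
     + (fa i - 1 / 2) * H i j + G i j * fb j + H i j * fa j
     + (- fa i) * fb j + (- fb i) * fa j + (-1) * (fa j * fb j))).
    by apply: eq_bigr => j _; rewrite cE; field.
  rewrite !big_split /= -!mulr_sumr sumr_const -mulr_natl Gs Hs fas fbs -/P cE.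
  by field.
rewrite (eq_bigr _ (fun i _ => inner i)).
have [c cE] : exists c, c = #|I|%:R / 4 - s - P by eexists.
rewrite -cE !big_split /= -!mulr_sumr sumr_const.
have mixed (K : I -> I -> R) h : (forall i j, K i j = K j i) ->
    (forall i, \sum_j K i j = s) -> \sum_i h i = s ->
    \sum_i \sum_j K i j * h j = s ^+ 2.
  move=> KC Ks hs; rewrite exchange_big /=.
  under eq_bigr => j _.
    rewrite -mulr_suml (eq_bigr (fun i => K j i)) ?Ks; last by move=> i _.
    over.
  by rewrite -mulr_sumr hs.
by rewrite !mixed// -mulr_natl -/P cE; field.
Qed.

End Sums.

(** * Integrating the square of the discrepancy *)

Section Expansion.
Variable R : realType.
Notation leb := (@lebesgue_measure R).
Notation RT := (measurableTypeR R).

(** For the discrepancy function of points [(a i, b i)], every term of the expanded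
square is a product over the two coordinates. *)
Lemma has_iint_square (E : RT -> set RT) (A : R -> R -> R) (B : R -> R) (C : R)
    (I : finType) (a b : I -> R) (N : R) :
  (forall x, measurable (E x)) ->
  (forall i, 0 <= a i < 1) -> (forall i, 0 <= b i < 1) ->
  (forall s t, 0 <= s < 1 -> 0 <= t < 1 ->
     has_iint leb `[0, 1[ E (fun x y => arc_mem s x y * arc_mem t x y) (A s t)) ->
  (forall s, 0 <= s < 1 ->
     has_iint leb `[0, 1[ E (fun x y => arc_mem s x y * arc_len x y) (B s)) ->
  has_iint leb `[0, 1[ E (fun x y => arc_len x y * arc_len x y) C ->
  has_iint (leb \x leb)%E (unit_square R) (fun x => E x.1 `*` E x.2)
    (fun x y => (\sum_i arc_mem (a i) x.1 y.1 * arc_mem (b i) x.2 y.2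
                 - N * (arc_len x.1 y.1 * arc_len x.2 y.2)) ^+ 2)
    (\sum_i \sum_j A (a i) (a j) * A (b i) (b j)
     + (- 2 * N) * (\sum_i B (a i) * B (b i)) + N ^+ 2 * (C * C)).
Proof.
move=> mE a01 b01 hA hB hC.
have mI : measurable (`[0, 1[ : set RT) by exact: measurable_itv.
have mSq : measurable (unit_square R : set (RT * RT)) by exact: measurableX.
have mE2 (x : RT * RT) : measurable (E x.1 `*` E x.2) by exact: measurableX.
have hmm i j := has_iint_prod mI mI mE mE (hA _ _ (a01 i) (a01 j)) (hA _ _ (b01 i) (b01 j)).
have hml i := has_iint_prod mI mI mE mE (hB _ (a01 i)) (hB _ (b01 i)).
have hll := has_iint_prod mI mI mE mE hC hC.
have hsum := has_iintD mSq mE2 (has_iintD mSq mE2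
  (has_iint_sum mSq mE2 (fun i => has_iint_sum mSq mE2 (hmm i)))
  (has_iintZ mSq mE2 (- 2 * N) (has_iint_sum mSq mE2 hml)))
  (has_iintZ mSq mE2 (N ^+ 2) hll).
apply: (has_iint_eq mE2 _ hsum) => x y _ _ /=.
set L := arc_len x.1 y.1 * arc_len x.2 y.2.
pose m i := arc_mem (a i) x.1 y.1 * arc_mem (b i) x.2 y.2.
rewrite (_ : \sum_i \sum_j _ = (\sum_i m i) * (\sum_i m i)); last first.
  rewrite big_distrlr /=; apply: eq_bigr => i _; apply: eq_bigr => j _.
  by rewrite mulrACA.
rewrite (_ : \sum_i arc_mem (a i) x.1 y.1 * arc_len x.1 y.1 * _ = (\sum_i m i) * L); last first.
  by rewrite mulr_suml; apply: eq_bigr => i _; rewrite mulrACA.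
rewrite -/L -(mulrACA (arc_len x.1 y.1)) -/L.
by rewrite -/(m _); ring.
Qed.

(** * The discrepancy of a permutation set *)

Lemma measure_per_itv (x y : R) : 0 <= x < 1 -> 0 <= y < 1 ->
  measurable (per_itv x y : set RT) /\
  leb (per_itv x y) = (arc_len x y)%:E.
Proof.
move=> /andP[x0 x1] /andP[y0 y1]; rewrite /per_itv /arc_len; case: ltP => xy.
  have -> : [set z | 0 <= z < 1 /\ x <= z < y] = `[x, y[%classic.
    apply/seteqP; split => z /=; rewrite in_itv /=; first by case.
    by move=> /[dup] xzy /andP[xz zy]; split => //; apply/andP; split; lra.
  by split => //; rewrite lebesgue_measure_itv /= lte_fin xy.
have -> : [set z | 0 <= z < 1 /\ (x <= z \/ z < y)] = `[0, y[%classic `|` `[x, 1[%classic.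
  apply/seteqP; split => z /=; rewrite !in_itv /=.
    by move=> [/andP[z0 z1] [xz|zy]]; [right|left]; apply/andP.
  by move=> [|] /andP[z0 z1]; (split; [apply/andP; split; lra|]); [right|left].
split; first exact: measurableU.
transitivity (leb `[0%R, y[%classic + leb `[x, 1%R[%classic)%E.
  apply: measureU => //.
  by apply/seteqP; split => // z /=; rewrite !in_itv /= => -[/andP[_ ?] /andP[? _]]; lra.
rewrite !lebesgue_measure_itv /= !lte_fin x1.
case: ltP => y0'; rewrite -?EFinB -?EFinD ?add0e; congr EFin; lra.
Qed.

Lemma mu2_per_box (x y : R * R) : unit_square R x -> unit_square R y ->
  fine (mu2 R (per_box x y)) = arc_len x.1 y.1 * arc_len x.2 y.2.
Proof.
rewrite /unit_square /= !in_itv /= => -[x1 x2] [y1 y2].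
have [m1 l1] := measure_per_itv x1 y1; have [m2 l2] := measure_per_itv x2 y2.
by rewrite /mu2 /per_box product_measure1E// [X in (X * _)%E]l1 [X in (_ * X)%E]l2.
Qed.

Lemma per_itv_mem (s x y : R) : 0 <= s < 1 -> (s \in per_itv x y)%:R = arc_mem s x y.
Proof.
move=> s01; rewrite /per_itv /arc_mem; congr (_%:R); congr nat_of_bool.
case: ifP => _; apply/idP/idP; rewrite inE /=.
- by case.
- by move=> ?; split.
- by move=> [_ /orP].
- by move=> /orP ?; split.
Qed.

Definition grid (N : nat) (i : 'I_N) : R := i%:R / N%:R.

Lemma grid01 N (i : 'I_N) : 0 <= grid i < 1.
Proof.
have N_gt0 : (0 < N)%N by exact: leq_ltn_trans (ltn_ord i).
by rewrite /grid divr_ge0 ?ler0n//= ltr_pdivrMr ?ltr0n// mul1r ltr_nat.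
Qed.

Lemma grid_inj N : injective (@grid N).
Proof.
move=> i j; have N_gt0 : (0 < N)%N by exact: leq_ltn_trans (ltn_ord i).
move=> /(congr1 (fun z => z * N%:R)).
rewrite !divfK ?pnatr_eq0 -?lt0n// => /eqP; rewrite eqr_nat => /eqP.
exact: val_inj.
Qed.

Section PermSet.
Variables (N : nat) (sigma : 'S_N).

Let point_inj : injective (fun i : 'I_N => (grid i, grid (sigma i))).
Proof. by move=> i j [/grid_inj]. Qed.

Lemma card_perm_set : #|` perm_set R sigma| = N.
Proof. by rewrite /perm_set card_imfset//= -cardE card_ord. Qed.

Lemma perm_set_discrepancy (x y : R * R) : unit_square R x -> unit_square R y ->
  discrepancy (perm_set R sigma) x y
  = \sum_i arc_mem (grid i) x.1 y.1 * arc_mem (grid (sigma i)) x.2 y.2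
    - N%:R * (arc_len x.1 y.1 * arc_len x.2 y.2).
Proof.
move=> xS yS; rewrite /discrepancy mu2_per_box// card_perm_set; congr (_ - _).
rewrite -sum1_size big_fset /= /perm_set big_mkcond big_imfset /=; last exact: in2W.
rewrite natr_sum big_enum /=; apply: eq_bigr => i _.
rewrite -!per_itv_mem ?grid01// /per_box in_setX /=.
by case: (_ \in _); case: (_ \in _); rewrite ?mulr1 ?mul0r ?mulr0.
Qed.

End PermSet.
End Expansion.

(** * The two discrepancies of a permutation set *)

Section Main.
Variable R : realType.
Notation leb := (@lebesgue_measure R).
Notation RT := (measurableTypeR R).

Lemma sqrt_fine_sqr (z : \bar R) (v : R) : (0 <= z)%E -> z = v%:E ->
  Num.sqrt (fine z) ^+ 2 = v.
Proof. by move=> z0 zv; rewrite sqr_sqrtr ?fine_ge0// zv. Qed.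

Section PermSet.
Variables (N : nat) (sigma : 'S_N).
Notation a i := (grid R i).
Notation b i := (grid R (sigma i)).

Lemma L2_per_sqr : L2_per (perm_set R sigma) ^+ 2 =
  \sum_i \sum_j (1 / 2 - qdist (a i) (a j)) * (1 / 2 - qdist (b i) (b j))
  + (- 2 * N%:R) * (\sum_(i < N) 1 / 3 * (1 / 3)) + N%:R ^+ 2 * (1 / 3 * (1 / 3)).
Proof.
apply: sqrt_fine_sqr.
  by apply: integral_ge0 => x _; apply: integral_ge0 => y _; rewrite lee_fin sqr_ge0.
have mE (x : RT) : measurable (`[(0:R), (1:R)[%classic : set RT) by exact: measurable_itv.
have := has_iint_square N%:R mE (@grid01 R N) (fun i => grid01 R (sigma i)) (@periodic_mem_mem R)
  (fun s s01 => periodic_mem_len (andP s01).1 (andP s01).2) (periodic_len_len R).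
move=> /has_iint_integral <-.
apply: eq_integral => x; rewrite inE => xS.
apply: eq_integral => y; rewrite inE => yS.
by rewrite perm_set_discrepancy.
Qed.

Lemma L2_extr_sqr : L2_extr (perm_set R sigma) ^+ 2 =
  \sum_i \sum_j ((a i * (1 - a i) + a j * (1 - a j) - qdist (a i) (a j)) / 2
                 * ((b i * (1 - b i) + b j * (1 - b j) - qdist (b i) (b j)) / 2))
  + (- 2 * N%:R) * (\sum_i (a i * (1 - a i) / 2) * (b i * (1 - b i) / 2))
  + N%:R ^+ 2 * (1 / 12 * (1 / 12)).
Proof.
apply: sqrt_fine_sqr.
  by apply: integral_ge0 => x _; apply: integral_ge0 => y _; rewrite lee_fin sqr_ge0.
have mE (x : RT) : measurable (`](x:R), (1:R)[%classic : set RT) by exact: measurable_itv.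
have := has_iint_square N%:R mE (@grid01 R N) (fun i => grid01 R (sigma i)) (@extreme_mem_mem R)
  (fun s s01 => extreme_mem_len (andP s01).1 (andP s01).2) (extreme_len_len R).
move=> /has_iint_integral <-.
apply: eq_integral => x; rewrite inE => xS.
have -> : [set y | unit_square R y /\ x.1 < y.1 /\ x.2 < y.2] =
    `]x.1, 1[%classic `*` `]x.2, 1[%classic.
  move: xS; rewrite /unit_square /= !in_itv /= => -[/andP[x10 _] /andP[x20 _]].
  apply/seteqP; split => y /=; rewrite !in_itv /=.
    by move=> [[/andP[_ ->] /andP[_ ->]] [-> ->]].
  move=> [/andP[xy1 ->] /andP[xy2 ->]]; rewrite xy1 xy2 !andbT.
  by rewrite (le_trans x10 (ltW xy1)) (le_trans x20 (ltW xy2)).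
apply: eq_integral => y; rewrite inE => -[y1 y2].
rewrite perm_set_discrepancy//; move: xS y1 y2.
rewrite /unit_square /= !in_itv /= => -[/andP[x10 _] /andP[x20 _]].
move=> /andP[xy1 ->] /andP[xy2 ->]; rewrite !andbT.
by rewrite (le_trans x10 (ltW xy1)) (le_trans x20 (ltW xy2)).
Qed.

End PermSet.
End Main.

Unset Implicit Arguments.

Theorem theorem1p2 (R : realType) (N : nat) (hN : (1 <= N)%N) (sigma : 'S_N) :
  L2_per (perm_set R sigma) ^+ 2 - 4 * L2_extr (perm_set R sigma) ^+ 2
  = (N%:R ^+ 2 + 1) / (18 * N%:R ^+ 2).
Proof.
rewrite L2_per_sqr L2_extr_sqr.
set a := @grid R N.
pose s : R := (N%:R ^+ 2 - 1) / (6 * N%:R).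
pose f (t : R) := t * (1 - t).
have N0 : N%:R != 0 :> R by rewrite pnatr_eq0 -lt0n.
have perm_sum (F : R -> R) : \sum_i F (a (sigma i)) = \sum_i F (a i).
  by rewrite [RHS](reindex_inj (@perm_inj _ sigma)).
have fas : \sum_i f (a i) = s by exact: sum_grid.
have fbs : \sum_i f (a (sigma i)) = s by rewrite perm_sum.
have Gs i : \sum_j qdist (a i) (a j) = s by exact: sum_qdist.
have Hs i : \sum_j qdist (a (sigma i)) (a (sigma j)) = s.
  by rewrite (perm_sum (qdist (a (sigma i)))); exact: sum_qdist.
have := sum_defect (fun i j => qdistC (a i) (a j)) (fun i j => qdistC (a (sigma i)) (a (sigma j)))
  Gs Hs fas fbs.
rewrite card_ord => defect.
rewrite sumr_const card_ord -(mulr_natl (1 / 3 * _)).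
have -> : \sum_(i < N) a i * (1 - a i) / 2 * (a (sigma i) * (1 - a (sigma i)) / 2)
    = 1 / 4 * \sum_i f (a i) * f (a (sigma i)).
  by rewrite mulr_sumr; apply: eq_bigr => i _; rewrite /f; field.
set X := \sum_i \sum_j _; set Y := \sum_i \sum_j _.
have XY : X - 4 * Y = N%:R ^+ 2 / 4 - N%:R * s + 2 * s ^+ 2
    - 2 * N%:R * \sum_i f (a i) * f (a (sigma i)).
  rewrite -defect mulr_sumr -sumrB; apply: eq_bigr => i _.
  by rewrite mulr_sumr -sumrB; apply: eq_bigr => j _; rewrite /f; field.
rewrite -[X](subrK (4 * Y)) XY /s; field.
exact: N0.
Qed.
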